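(* Let $\mathcal G$ be a connected undirected weighted graph on $N\ge2$ vertices with Laplacian matrix $\mathcal L$, and let $\lambda_2$ and $\lambda_N$ be the smallest and the largest nonzero eigenvalues of $\mathcal L$, respectively. Consider the system with two-tap memory $$x(k+1)=((1+\theta_0)I-\alpha\mathcal L)x(k)+\theta_1x(k-1)+\theta_2x(k-2),\qquad \theta_0+\theta_1+\theta_2=0,$$ and the optimal convergence rate $$\gamma_2^*=\min_{\{\alpha,\theta_0,\theta_1,\theta_2\}}\ \max_{i\in\{1,2,N\}}\bar r(h_i(z)),$$ the minimum being over real $\alpha,\theta_0,\theta_1,\theta_2$ with $\theta_0+\theta_1+\theta_2=0$, where $$h_1(z)=z^2-\theta_0z-(\theta_0+\theta_1),\qquad h_i(z)=z^3-(1+\theta_0-\alpha\lambda_i)z^2-\theta_1z-\theta_2\quad(i=2,N),$$ and $\bar r(h)$ is the maximum modulus of the roots of $h$. Then $$\gamma_2^*=\frac{\sqrt{\lambda_N/\lambda_2}-1}{\sqrt{\lambda_N/\lambda_2}+1},$$ and the corresponding optimal parameters are $$\alpha^*=\frac{4}{(\sqrt{\lambda_N}+\sqrt{\lambda_2})^2},\qquad \theta_0^*=\left(\frac{\sqrt{\lambda_N/\lambda_2}-1}{\sqrt{\lambda_N/\lambda_2}+1}\right)^2,\qquad \theta_1^*=-\theta_0^*,\qquad \theta_2^*=0.$$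
   Context: The graph is undirected with adjacency matrix $\mathcal A=[a_{ij}]$, $a_{ii}=0$, $a_{ij}=a_{ji}>0$ iff $i$ and $j$ are adjacent (and $a_{ij}=0$ otherwise). The Laplacian is $\mathcal L=\mathcal D-\mathcal A$ with $\mathcal D=\mathrm{diag}(d_1,\dots,d_N)$, $d_i=\sum_j a_{ij}$; its eigenvalues are $0=\lambda_1<\lambda_2\le\cdots\le\lambda_N$. ''Optimal parameters'' means parameters at which the minimum defining $\gamma_2^*$ is attained. *)

(* Defs.v *)
From mathcomp Require Import all_boot all_order all_algebra.
From mathcomp Require Import complex reals.

Set Implicit Arguments.
Unset Strict Implicit.
Unset Printing Implicit Defensive.

Import Order.TTheory GRing.Theory Num.Theory.
Local Open Scope ring_scope.

Definition simple_graph (N : nat) (e : rel 'I_N) : Prop :=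
  symmetric e /\ irreflexive e.

Definition connected_graph (N : nat) (e : rel 'I_N) : Prop :=
  forall i j, connect e i j.

Definition weighted_adjacency (R : realType) (N : nat) (e : rel 'I_N)
    (A : 'M[R]_N) : Prop :=
  [/\ forall i, A i i = 0,
      forall i j, A i j = A j i,
      forall i j, e i j -> 0 < A i j
    & forall i j, ~~ e i j -> A i j = 0].

Definition laplacian (R : realType) (N : nat) (A : 'M[R]_N) : 'M[R]_N :=
  diag_mx (\row_i \sum_j A i j) - A.

Definition smallest_nonzero_eigenvalue (R : realType) (N : nat)
    (L : 'M[R]_N) (l : R) : Prop :=
  [/\ eigenvalue L l, l != 0
    & forall m, eigenvalue L m -> m != 0 -> l <= m].

Definition largest_nonzero_eigenvalue (R : realType) (N : nat)
    (L : 'M[R]_N) (l : R) : Prop :=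
  [/\ eigenvalue L l, l != 0
    & forall m, eigenvalue L m -> m != 0 -> m <= l].

(* All complex roots of p, with multiplicity (for p != 0). *)
Definition complex_roots (R : realType) (p : {poly R}) : seq R[i] :=
  sval (closed_field_poly_normal (map_poly (real_complex R) p)).

(* Moduli are nonnegative, so the default value 0 of the maximum only matters
   for polynomials without roots. *)
Definition max_root_modulus (R : realType) (p : {poly R}) : R :=
  \big[Num.max/0]_(z <- complex_roots p) Normc.normc z.

(* Along an eigenvector of the Laplacian with eigenvalue lam, the system
     x(k+1) = ((1 + th0) I - al L) x(k) + th1 x(k-1) + th2 x(k-2)
   is a scalar recursion with characteristic polynomial h_eig. For lam = 0 and
   th0 + th1 + th2 = 0, h_eig is ('X - 1) * h_consensus; the root 1, which
   carries the consensus value, is left out of the rate. *)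
Definition h_consensus (R : realType) (th0 th1 : R) : {poly R} :=
  'X^2 - th0 *: 'X - (th0 + th1)%:P.

Definition h_eig (R : realType) (al th0 th1 th2 lam : R) : {poly R} :=
  'X^3 - (1 + th0 - al * lam) *: 'X^2 - th1 *: 'X - th2%:P.

Definition conv_rate (R : realType) (l2 lN al th0 th1 th2 : R) : R :=
  Num.max (max_root_modulus (h_consensus th0 th1))
    (Num.max (max_root_modulus (h_eig al th0 th1 th2 l2))
             (max_root_modulus (h_eig al th0 th1 th2 lN))).

Definition is_optimal_rate (R : realType) (l2 lN g : R) : Prop :=
  (exists al th0 th1 th2 : R,
     th0 + th1 + th2 = 0 /\ conv_rate l2 lN al th0 th1 th2 = g) /\
  (forall al th0 th1 th2 : R,
     th0 + th1 + th2 = 0 -> g <= conv_rate l2 lN al th0 th1 th2).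

Definition optimal_parameters (R : realType) (l2 lN al th0 th1 th2 : R)
    : Prop :=
  th0 + th1 + th2 = 0 /\
  is_optimal_rate l2 lN (conv_rate l2 lN al th0 th1 th2).

(* Main.v *)
(* Put r = (sqrt (lN / l2) - 1) / (sqrt (lN / l2) + 1), so that
   (1 + r)^2 l2 = (1 - r)^2 lN. At the claimed parameters the polynomials are
   z (z - r^2), z (z - r)^2 and z (z + r)^2, so the rate is r. Conversely, it
   suffices to show that every choice of rate at most r is the claimed one.
   After the rescaling z = r w the cubics for l2 and lN are
   w^3 - s w^2 + b w - t with the same b and t, all of whose roots lie in the
   closed unit disc, and the relation between r, l2 and lN is an affine
   relation between the two values of s. Jury's necessary conditions on
   (s, b, t) contradict this relation unless t = 0 and b = 1, and then they
   determine both values of s. The case r = 0 is immediate since all roots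
   vanish. *)
Require Import Defs.
From mathcomp Require Import all_boot all_order all_algebra.
From mathcomp Require Import complex reals ring lra.

Import Order.TTheory GRing.Theory Num.Theory.
Local Open Scope ring_scope.

(** * Jury conditions and the extremal pair of cubics *)

(* Necessary conditions for the roots of z^3 - s z^2 + b z - t to lie in the
   closed unit disc. Jury's inequalities leave s unbounded for [t = 1], hence
   the extra [s <= 3]. *)
Definition jury_cubic {R : realFieldType} (s b t : R) : Prop :=
  [/\ s <= 1 + b - t, - (1 + b + t) <= s, b - 1 + t ^+ 2 <= t * s,
      t * s <= 1 + b - t ^+ 2 & s <= 3].

(** The cubic is (z - x)(z^2 - p z + m). Its signs at 1 and -1 give the first two conditions as
    products of nonnegative factors. *)
Lemma jury_cubic_factored {R : realFieldType} (x p m : R) :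
  `|x| <= 1 -> `|m| <= 1 -> `|p| <= 1 + m ->
  jury_cubic (x + p) (m + x * p) (x * m).
Proof.
rewrite !ler_norml => /andP[x1 x2] /andP[m1 m2] /andP[p1 p2].
have /andP[xm2 xm1] : -1 <= x * m <= 1.
  by rewrite -ler_norml normrM mulr_ile1 // ler_norml ?x1 ?m1.
split; last by lra.
- have : 0 <= (1 - x) * (1 - p + m) by apply: mulr_ge0; lra.
  lra.
- have : 0 <= (1 + x) * (1 + p + m) by apply: mulr_ge0; lra.
  lra.
(* The reversed quadratic at [x] is affine in [p]; at [p = 1 + m] and [p = -(1 + m)] it equals
   [(1 - x) * (1 - x * m)] and [(1 + x) * (1 + x * m)]. *)
- have h : 0 <= 1 - x * p + x ^+ 2 * m.
    have h1 : 0 <= (1 - x) * (1 - x * m) by apply: mulr_ge0; lra.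
    have h2 : 0 <= (1 + x) * (1 + x * m) by apply: mulr_ge0; lra.
    have [x0|x0] := leP 0 x.
      have : 0 <= x * (1 + m - p) by apply: mulr_ge0; lra.
      lra.
    have : 0 <= (- x) * (p + (1 + m)) by apply: mulr_ge0; lra.
    lra.
  have : 0 <= (1 - m) * (1 - x * p + x ^+ 2 * m) by apply: mulr_ge0; lra.
  lra.
- have h1 : 0 <= (1 + m) * ((1 + x) * (1 - x * m)).
    by apply: mulr_ge0; [lra | apply: mulr_ge0; lra].
  have h2 : 0 <= (1 + m) * ((1 - x) * (1 + x * m)).
    by apply: mulr_ge0; [lra | apply: mulr_ge0; lra].
  have [x0|x0] := leP 0 x.
    have : 0 <= x * (1 - m) * (p + (1 + m)).
      by apply: mulr_ge0; [apply: mulr_ge0; lra | lra].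
    lra.
  have : 0 <= (- x) * (1 - m) * (1 + m - p).
    by apply: mulr_ge0; [apply: mulr_ge0; lra | lra].
  lra.
Qed.

(** The right side of the relation increases in [s1] and decreases in [s2]. An upper bound on [s1]
    and a lower bound on [s2] thus leave an inequality in [r], [b], [t]; the sign of [t] decides
    which bounds are sharp enough. *)
Lemma jury_cubic_pair {R : realFieldType} (r b t s1 s2 : R) :
  0 < r < 1 -> jury_cubic s1 b t -> jury_cubic s2 b t ->
  4 * (1 + r ^+ 2 * b - r ^+ 3 * t)
    = (1 + r) ^+ 2 * s1 - (1 - r) ^+ 2 * s2 ->
  [/\ t = 0, b = 1 & s1 = 2].
Proof.
move=> /andP[r0 r1] [U1 L1 T1 M1 B1] [U2 L2 T2 M2 B2] F.
have r2 : 0 < 1 - r ^+ 2 by nra.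
have a1 : 0 < (1 + r) ^+ 2 by apply: exprn_gt0; lra.
have a2 : 0 < (1 - r) ^+ 2 by apply: exprn_gt0; lra.
(* The signs of the cubics at 1 and -1 already settle [b < 1 + 2 r t]. *)
have bge : 1 + 2 * r * t <= b.
  have h1 : 0 <= (1 + r) ^+ 2 * (1 + b - t - s1) by apply: mulr_ge0; lra.
  have h2 : 0 <= (1 - r) ^+ 2 * (s2 + (1 + b + t)) by apply: mulr_ge0; lra.
  have : (1 - r ^+ 2) * (1 + 2 * r * t - b) <= 0 by lra.
  by rewrite pmulr_rle0 // subr_le0.
have t2 : t ^+ 2 <= 1 by lra.
have /andP[tl tu] : -1 <= t <= 1 by apply/andP; split; nra.
case: (ltgtP t 0) => [tneg|tpos|t0].
- case: (eqVneq t (-1)) => [tE|tN].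
    (* The two bounds on [t * s] now coincide, so both cubics have [s = - b], and [F] makes this
       positive product vanish. *)
    subst t; have : 0 < (1 + r) * ((1 - r) ^+ 2 + r * (b + 1)).
      apply: mulr_gt0; first lra.
      apply: ltr_wpDr => //; apply: mulr_ge0; lra.
    have s1E : s1 = - b by lra.
    have s2E : s2 = - b by lra.
    subst s1 s2; lra.
  have tgt : -1 < t by rewrite lt_neqAle eq_sym tN.
  (* When the cubic has the roots t, exp(i phi), exp(- i phi), c is cos phi. *)
  pose c := (b - 1) / (2 * t).
  have bE : b = 1 + 2 * t * c by rewrite /c; field; lra.
  have {}bE2 : forall s, b - 1 + t ^+ 2 <= t * s -> s <= t + 2 * c.
    move=> s hs; rewrite -(ler_nM2l tneg); lra.
  have {T1 T2} := (bE2 _ T1, bE2 _ T2) => -[T1 T2]; clearbody c.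
  have cr : c <= r by rewrite -(ler_nM2l tneg); lra.
  (* The upper bound [t + 2 * c] on [s1] must not fall below [-(1 + b + t)]. *)
  have c1 : -1 <= c.
    have : 0 <= (1 + t) * (1 + c) by lra.
    by rewrite pmulr_rge0; lra.
  have h1 : 0 <= (1 + r) ^+ 2 * (t + 2 * c - s1) by apply: mulr_ge0; lra.
  have h2 : 0 <= (1 - r) ^+ 2 * (s2 + (1 + b + t)) by apply: mulr_ge0; lra.
  exfalso; subst b.
  (* [G] is affine, so its sign on [-1, r] is decided at the endpoints. *)
  pose G u := 4 * (1 + r ^+ 2 * (1 + 2 * t * u) - r ^+ 3 * t)
    - (1 + r) ^+ 2 * (t + 2 * u) - (1 - r) ^+ 2 * (2 + 2 * t * u + t).
  have Gc : (1 + r) * G c <= 0 by rewrite pmulr_rle0 /G; lra.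
  have Gl : 0 < G (-1).
    have -> : G (-1)
        = 4 * (1 + r ^+ 2 + (- t) * (r ^+ 2 * (2 + r)) + r * (2 - t)).
      by rewrite /G; ring.
    have : 0 < (- t) * (r ^+ 2 * (2 + r)).
      by apply: mulr_gt0; [lra | apply: mulr_gt0; [exact: exprn_gt0 | lra]].
    have : 0 < r * (2 - t) by apply: mulr_gt0; lra.
    have : 0 < r ^+ 2 by exact: exprn_gt0.
    lra.
  have Gr : 0 < G r.
    have -> : G r = 2 * (1 - t) * ((1 + r) ^+ 2 * (1 - r)) by rewrite /G; ring.
    by apply: mulr_gt0; [lra | apply: mulr_gt0; lra].
  have GE : (1 + r) * G c = (r - c) * G (-1) + (1 + c) * G r.
    by rewrite /G; ring.
  have [cltr|rlec] := ltP c r.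
    have : 0 < (r - c) * G (-1) by apply: mulr_gt0; lra.
    have : 0 <= (1 + c) * G r by apply: mulr_ge0; lra.
    lra.
  have : 0 <= (r - c) * G (-1) by apply: mulr_ge0; lra.
  have : 0 < (1 + c) * G r by apply: mulr_gt0; lra.
  lra.
- case: (eqVneq t 1) => [tE|tN].
    (* Again the bounds on [t * s] coincide, now with [s = b]; [s1 <= 3] makes [3 - b]
       nonnegative. *)
    subst t; have : 0 < (1 - r) * ((1 - r) ^+ 2 + r * (3 - b)).
      apply: mulr_gt0; first lra.
      apply: ltr_wpDr => //; apply: mulr_ge0; lra.
    have s1E : s1 = b by lra.
    have s2E : s2 = b by lra.
    subst s1 s2; lra.
  have tlt : t < 1 by rewrite lt_neqAle tN.
  pose c := (b - 1) / (2 * t).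
  have bE : b = 1 + 2 * t * c by rewrite /c; field; lra.
  have bE2 : forall s, b - 1 + t ^+ 2 <= t * s -> t + 2 * c <= s.
    move=> s hs; rewrite -(ler_pM2l tpos); lra.
  have {T1 T2} := (bE2 _ T1, bE2 _ T2) => -[T1 T2]; clearbody c.
  have cr : r <= c by rewrite -(ler_pM2l tpos); lra.
  have c1 : c <= 1.
    have : 0 <= (1 - t) * (1 - c) by lra.
    by rewrite pmulr_rge0; lra.
  have h1 : 0 <= (1 + r) ^+ 2 * (1 + b - t - s1) by apply: mulr_ge0; lra.
  have h2 : 0 <= (1 - r) ^+ 2 * (s2 - (t + 2 * c)) by apply: mulr_ge0; lra.
  exfalso; subst b.
  (* With the bounds [h1] and [h2] inserted, [F] says [2 * (1 - r) * H c <= 0]. [H] is affine, and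
     positive at both ends of [-1, 1]. *)
  pose H u := 1 - r + t * (1 + r + 2 * r ^+ 2) + u * (1 - r - t * (1 + 3 * r)).
  have Hc : H c <= 0.
    have : 2 * (1 - r) * H c <= 0 by rewrite /H; lra.
    by rewrite pmulr_rle0 //; lra.
  have HE : 2 * H c = (1 - c) * (2 * t * (1 + r) ^+ 2)
                      + (1 + c) * (2 * (1 - r) * (1 - r * t)).
    by rewrite /H; ring.
  have rt : r * t < 1 by rewrite -(mulr1 1); apply: ltr_pM; lra.
  have : 0 <= (1 - c) * (2 * t * (1 + r) ^+ 2).
    by apply: mulr_ge0; [lra | apply: mulr_ge0; lra].
  have : 0 < (1 + c) * (2 * (1 - r) * (1 - r * t)).
    by apply: mulr_gt0; [lra | apply: mulr_gt0; lra].
  lra.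
- subst t.
  have b1 : b = 1 by lra.
  subst b.
  split=> //.
  have h2 : 0 <= (1 - r) ^+ 2 * (s2 + 2) by apply: mulr_ge0; lra.
  have : (1 + r) ^+ 2 * (2 - s1) <= 0 by lra.
  rewrite pmulr_rle0 // => h; lra.
Qed.

(** * Root moduli; real quadratics and cubics *)

Lemma mem_complex_roots {R : realType} (p : {poly R}) (z : R[i]) :
  p != 0 ->
  (z \in complex_roots p) = root (map_poly (real_complex R) p) z.
Proof.
move=> p0; rewrite /complex_roots.
case: closed_field_poly_normal => s /= pE; rewrite [in RHS]pE.
by rewrite rootZ ?root_prod_XsubC // lead_coef_eq0 map_poly_eq0.
Qed.

Lemma normc_le_max_root_modulus {R : realType} (p : {poly R}) (z : R[i]) :
  p != 0 -> root (map_poly (real_complex R) p) z ->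
  Normc.normc z <= max_root_modulus p.
Proof.
move=> p0; rewrite -mem_complex_roots // => zp.
exact: (le_bigmax_seq _ z xpredT).
Qed.

Lemma max_root_modulus_le {R : realType} (p : {poly R}) (r : R) :
  p != 0 -> 0 <= r ->
  (forall z, root (map_poly (real_complex R) p) z -> Normc.normc z <= r) ->
  max_root_modulus p <= r.
Proof.
move=> p0 r0 le_r; rewrite /max_root_modulus big_seq; apply: bigmax_le => // z.
by rewrite mem_complex_roots //; apply: le_r.
Qed.

Lemma normc_real {R : realType} (x : R) : Normc.normc (real_complex R x) = `|x|.
Proof. by rewrite /= expr0n addr0 sqrtr_sqr. Qed.

(** The proof splits on the sign of the discriminant. The middle bound avoids division by [r]; at
    [r = 0] it no longer controls [p], and the last bound does. *)
Lemma quadratic_roots_in_disc {R : realType} (p m r : R) :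
  0 <= r ->
  (forall z : R[i], z ^+ 2 - real_complex R p * z + real_complex R m = 0 ->
     Normc.normc z <= r) ->
  [/\ `|m| <= r ^+ 2, `|p| * r <= r ^+ 2 + m & `|p| <= 2 * r].
Proof.
move=> r0 disc; have [D0|D0] := leP 0 (p ^+ 2 - 4 * m).
  pose w := Num.sqrt (p ^+ 2 - 4 * m).
  have w2 : w ^+ 2 = p ^+ 2 - 4 * m by rewrite sqr_sqrtr.
  have rt x : x ^+ 2 - p * x + m = 0 -> `|x| <= r.
    move=> x0; rewrite -normc_real; apply: disc.
    by rewrite -rmorphXn -!rmorphM -rmorphB -rmorphD x0 rmorph0.
  have ar := rt ((p + w) / 2) ltac:(by field: w2).
  have br := rt ((p - w) / 2) ltac:(by field: w2).
  have -> : p = (p + w) / 2 + (p - w) / 2 by field.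
  have -> : m = ((p + w) / 2) * ((p - w) / 2) by field: w2.
  move: ((p + w) / 2) ((p - w) / 2) ar br => a b ar br.
  split.
  - by rewrite normrM expr2; apply: ler_pM.
  - move: br ar; rewrite !ler_norml => /andP[b1 b2] /andP[a1 a2].
    have h1 : 0 <= (r - a) * (r - b) by apply: mulr_ge0; lra.
    have h2 : 0 <= (r + a) * (r + b) by apply: mulr_ge0; lra.
    by case: ger0P => _; lra.
  - by apply: le_trans (ler_normD _ _) _; lra.
pose w := Num.sqrt (4 * m - p ^+ 2).
have w2 : w ^+ 2 = 4 * m - p ^+ 2 by rewrite sqr_sqrtr //; lra.
have /disc : ((p / 2) +i* (w / 2))%C ^+ 2
    - real_complex R p * ((p / 2) +i* (w / 2))%C + real_complex R m = 0.
  rewrite expr2; simpc; apply/eqP; rewrite eq_complex /=.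
  by apply/andP; split; apply/eqP; field: w2.
(* For a conjugate pair the product [m] is the squared modulus. *)
have -> : Normc.normc ((p / 2) +i* (w / 2))%C = Num.sqrt m.
  by rewrite /=; congr Num.sqrt; field: w2.
move=> mr.
have m0 : 0 < m by have := sqr_ge0 p; lra.
have mr2 : m <= r ^+ 2.
  by rewrite -(sqr_sqrtr (ltW m0)) lerXn2r ?nnegrE ?sqrtr_ge0.
have p2 : `|p| ^+ 2 < 4 * m by rewrite real_normK ?num_real //; lra.
split; first by rewrite gtr0_norm.
  have rm0 : 0 <= r ^+ 2 + m by have := sqr_ge0 r; lra.
  (* After squaring: p^2 r^2 <= 4 m r^2 <= (r^2 + m)^2. *)
  rewrite -ler_sqr ?nnegrE ?mulr_ge0 // exprMn.
  have : 0 <= r ^+ 2 * (4 * m - `|p| ^+ 2) by rewrite mulr_ge0 ?sqr_ge0 //; lra.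
  have := sqr_ge0 (r ^+ 2 - m).
  lra.
rewrite -ler_sqr ?nnegrE ?mulr_ge0 // exprMn; lra.
Qed.

Lemma monic_cubic_root {R : realType} (s b t : R) :
  exists x, x ^+ 3 - s * x ^+ 2 + b * x - t = 0.
Proof.
pose q := 'X^3 - s *: 'X^2 + b *: 'X - t%:P.
have qE x : q.[x] = x ^+ 3 - s * x ^+ 2 + b * x - t by rewrite /q !hornerE.
(* A Cauchy-type bound: at [M] and [- M] the leading term dominates, so [q] changes sign. *)
pose M := 1 + `|s| + `|b| + `|t|.
have /andP[s1 s2] : - `|s| <= s <= `|s| by rewrite -ler_norml.
have /andP[b1 b2] : - `|b| <= b <= `|b| by rewrite -ler_norml.
have /andP[t1 t2] : - `|t| <= t <= `|t| by rewrite -ler_norml.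
have := normr_ge0 s; have := normr_ge0 b; have := normr_ge0 t => t0 b0 s0.
have M1 : 1 <= M by rewrite /M; lra.
have M2 : M <= M ^+ 2 by rewrite -[leLHS]mulr1 expr2 ler_wpM2l //; lra.
have bound : `|s| * M ^+ 2 + `|b| * M + `|t| <= M ^+ 3.
  have h1 : 0 <= `|b| * (M ^+ 2 - M) by apply: mulr_ge0; lra.
  have h2 : 0 <= `|t| * (M ^+ 2 - 1) by apply: mulr_ge0; lra.
  have h3 := sqr_ge0 M.
  have -> : M ^+ 3 = (1 + `|s| + `|b| + `|t|) * M ^+ 2 by rewrite -/M; ring.
  lra.
have hs1 : 0 <= (`|s| - s) * M ^+ 2 by apply: mulr_ge0; lra.
have hs2 : 0 <= (`|s| + s) * M ^+ 2 by apply: mulr_ge0; lra.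
have hb1 : 0 <= (`|b| + b) * M by apply: mulr_ge0; lra.
have hb2 : 0 <= (`|b| - b) * M by apply: mulr_ge0; lra.
have [||x _ /rootP] := @poly_ivt R q (- M) M; last by rewrite qE; exists x.
  lra.
rewrite !qE; apply/andP; split; lra.
Qed.

(** * Nonnegativity of the Laplacian spectrum *)

(** At an entry [v 0 i] of largest modulus, [l * v 0 i ^+ 2] is a sum of nonnegative terms
    [A i j * (v 0 i ^+ 2 - v 0 i * v 0 j)]. *)
Lemma laplacian_eigenvalue_ge0 {R : realType} (N : nat) (e : rel 'I_N)
    (A : 'M[R]_N) (l : R) :
  weighted_adjacency e A -> eigenvalue (laplacian A) l -> 0 <= l.
Proof.
move=> [_ Asym Apos A0] /eigenvalueP[v vL v0].
have Age0 i j : 0 <= A i j.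
  by case: (boolP (e i j)) => [/Apos/ltW //|/A0 ->].
have [i0 _] : exists i, v 0 i != 0 by apply/rV0Pn.
have [i _ imax] := @arg_maxP _ _ _ i0 predT (fun i => `|v 0 i|) isT.
have vi0 : 0 < v 0 i ^+ 2.
  rewrite lt_neqAle sqr_ge0 andbT eq_sym sqrf_eq0.
  apply: contraNneq v0 => vi; apply/eqP/rowP => j; rewrite mxE.
  apply/eqP; rewrite -normr_le0.
  by have := imax j isT; rewrite vi normr0.
rewrite -(pmulr_lge0 _ vi0).
have -> : l * v 0 i ^+ 2 = \sum_j A i j * (v 0 i ^+ 2 - v 0 i * v 0 j).
  have /esym := congr1 (fun u : 'rV[R]_N => u 0 i * v 0 i) vL.
  rewrite /laplacian mulmxBr mul_mx_diag !mxE mulrBl expr2 mulrA => ->.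
  rewrite mulr_sumr !mulr_suml -sumrB; apply: eq_bigr => j _.
  by rewrite Asym; ring.
apply: sumr_ge0 => j _; apply: mulr_ge0 => //.
rewrite subr_ge0; apply: le_trans (ler_norm _) _.
rewrite normrM -[leRHS]real_normK ?num_real // expr2 ler_wpM2l //.
exact: imax.
Qed.

(** * Roots of the characteristic polynomials *)

Lemma root_h_eig {R : realType} (al th0 th1 th2 lam : R) (z : R[i]) :
  root (map_poly (real_complex R) (h_eig al th0 th1 th2 lam)) z =
  (z ^+ 3 - real_complex R (1 + th0 - al * lam) * z ^+ 2
     - real_complex R th1 * z - real_complex R th2 == 0).
Proof.
rewrite /root /h_eig; move: (1 + th0 - _) => s.
rewrite !raddfB /= !map_polyZ /= !map_polyXn map_polyX map_polyC.
by rewrite !hornerE; congr (_ == 0); ring.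
Qed.

Lemma root_h_consensus {R : realType} (th0 th1 : R) (z : R[i]) :
  root (map_poly (real_complex R) (h_consensus th0 th1)) z =
  (z ^+ 2 - real_complex R th0 * z - real_complex R (th0 + th1) == 0).
Proof.
rewrite /root /h_consensus !raddfB /= !map_polyZ /= !map_polyXn map_polyX.
by rewrite map_polyC !hornerE.
Qed.

Lemma h_eig_neq0 {R : realType} (al th0 th1 th2 lam : R) :
  h_eig al th0 th1 th2 lam != 0.
Proof.
apply/eqP => /(congr1 (fun p : {poly R} => p`_3)) /eqP.
by rewrite /h_eig !coefE /= !mulr0 !subr0 oner_eq0.
Qed.

Lemma h_consensus_neq0 {R : realType} (th0 th1 : R) :
  h_consensus th0 th1 != 0.
Proof.
apply/eqP => /(congr1 (fun p : {poly R} => p`_2)) /eqP.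
by rewrite /h_consensus !coefE /= mulr0 !subr0 oner_eq0.
Qed.

(** Splitting off a real root [x] leaves a real quadratic, with [p] and [m] the sum and product of
    the other two roots; the disc condition becomes real inequalities. *)
Lemma h_eig_factor {R : realType} (al th0 th1 th2 lam r : R) :
  0 <= r -> max_root_modulus (h_eig al th0 th1 th2 lam) <= r ->
  exists x p m : R,
    [/\ `|x| <= r, `|m| <= r ^+ 2, `|p| * r <= r ^+ 2 + m & `|p| <= 2 * r] /\
    [/\ 1 + th0 - al * lam = x + p, - th1 = m + x * p & th2 = x * m].
Proof.
move=> r0 le_r.
set s := 1 + th0 - al * lam.
have {}disc z : z ^+ 3 - real_complex R s * z ^+ 2
    - real_complex R th1 * z - real_complex R th2 = 0 -> Normc.normc z <= r.
  move=> z0; apply: le_trans le_r; apply: normc_le_max_root_modulus.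
    exact: h_eig_neq0.
  by rewrite root_h_eig z0.
have [x x0] := monic_cubic_root s (- th1) th2.
pose p := s - x; pose m := - th1 - x * p.
have sE : s = x + p by rewrite /p; ring.
have th1E : th1 = - (m + x * p) by rewrite /m; ring.
have th2E : th2 = x * m by rewrite /m /p; lra.
exists x, p, m; split; last by split=> //; rewrite th1E opprK.
have factor z : z ^+ 3 - real_complex R s * z ^+ 2
    - real_complex R th1 * z - real_complex R th2
  = (z - real_complex R x)
    * (z ^+ 2 - real_complex R p * z + real_complex R m).
  by clearbody s p m; rewrite sE th1E th2E; ring.
have [] := @quadratic_roots_in_disc R p m r r0.
  by move=> z z0; apply: disc; rewrite factor z0 mulr0.
split=> //; rewrite -normc_real; apply: disc.
by rewrite factor subrr mul0r.
Qed.

(** * Uniqueness and attainment of the rate [r] *)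

Lemma conv_rate_le_optimal {R : realType} (l2 lN r al th0 th1 th2 : R) :
  0 <= r < 1 -> (1 + r) ^+ 2 * l2 = (1 - r) ^+ 2 * lN ->
  th0 + th1 + th2 = 0 -> conv_rate l2 lN al th0 th1 th2 <= r ->
  [/\ al * l2 = (1 - r) ^+ 2, th0 = r ^+ 2, th1 = - r ^+ 2 & th2 = 0].
Proof.
move=> /andP[r0 r1] ratio thE; rewrite /conv_rate !ge_max => /and3P[_].
move=> /(h_eig_factor _ _ _ _ _ _ r0)
  [x [p [m [[xr mr prm pr] [sE th1E th2E]]]]].
move=> /(h_eig_factor _ _ _ _ _ _ r0)
  [x' [p' [m' [[xr' mr' prm' pr'] [sE' th1E' th2E']]]]].
case: (eqVneq r 0) => [rE|rN].
  subst r; have x0 : x = 0 by apply/eqP; rewrite -normr_le0.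
  have m0 : m = 0 by apply/eqP; rewrite -normr_le0 (le_trans mr) // expr0n.
  have p0 : p = 0 by apply/eqP; rewrite -normr_le0 (le_trans pr) // mulr0.
  subst x m p; split; lra.
have {rN}r0 : 0 < r by rewrite lt_neqAle eq_sym rN.
have scaled y q n : `|y| <= r -> `|n| <= r ^+ 2 -> `|q| * r <= r ^+ 2 + n ->
    jury_cubic ((y + q) / r) ((n + y * q) / r ^+ 2) (y * n / r ^+ 3).
  move=> yr nr qr.
  have -> : (y + q) / r = y / r + q / r by field; lra.
  have -> : (n + y * q) / r ^+ 2 = n / r ^+ 2 + y / r * (q / r) by field; lra.
  have -> : y * n / r ^+ 3 = y / r * (n / r ^+ 2) by field; lra.
  apply: jury_cubic_factored.
  - by rewrite normf_div (gtr0_norm r0) ler_pdivrMr // mul1r.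
  - by rewrite normf_div [`|r ^+ 2|]gtr0_norm ?exprn_gt0 // ler_pdivrMr
      ?exprn_gt0 // mul1r.
  - rewrite normf_div (gtr0_norm r0) ler_pdivrMr //.
    have -> : (1 + n / r ^+ 2) * r = (r ^+ 2 + n) / r by field; lra.
    by rewrite ler_pdivlMr.
have := scaled _ _ _ xr mr prm; have := scaled _ _ _ xr' mr' prm'.
rewrite -sE -sE' -th1E -th1E' -th2E -th2E' => J' J.
(* The zero sum of the [th] turns the left side into [4 * (1 + th0)]. On the right [ratio] cancels
   [al], and (1 + r)^2 - (1 - r)^2 = 4 r. *)
have [||t0 b1 s2] := jury_cubic_pair r _ _ _ _ _ J J'; first by rewrite r0.
  have -> : 4 * (1 + r ^+ 2 * (- th1 / r ^+ 2) - r ^+ 3 * (th2 / r ^+ 3))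
          = 4 * (1 + th0).
    have -> : th0 = - th1 - th2 by lra.
    by field; lra.
  apply: (mulIf (lt0r_neq0 r0)); rewrite mulrBl.
  have -> : (1 + r) ^+ 2 * ((1 + th0 - al * l2) / r) * r
          = (1 + r) ^+ 2 * (1 + th0) - al * ((1 + r) ^+ 2 * l2) by field; lra.
  rewrite ratio.
  by field; lra.
have th20 : th2 = 0.
  by rewrite -(mulr0 (r ^+ 3)) -t0; field; lra.
have th1r : th1 = - r ^+ 2.
  by rewrite -[RHS]mulr1 -b1; field; lra.
have s2r : 1 + th0 - al * l2 = 2 * r.
  by rewrite -s2; field; lra.
split=> //; lra.
Qed.

Lemma conv_rate_optimal {R : realType} (l2 lN r al : R) :
  0 <= r < 1 -> al * l2 = (1 - r) ^+ 2 -> al * lN = (1 + r) ^+ 2 ->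
  conv_rate l2 lN al (r ^+ 2) (- r ^+ 2) 0 = r.
Proof.
move=> /andP[r0 r1] al2 alN.
have rc : Normc.normc (real_complex R r) = r by rewrite normc_real ger0_norm.
have h1 : max_root_modulus (h_consensus (r ^+ 2) (- r ^+ 2)) <= r.
  apply: max_root_modulus_le => // [|z]; first exact: h_consensus_neq0.
  rewrite root_h_consensus subrr rmorph0 subr0 expr2 -mulrBl mulf_eq0 subr_eq0.
  case/orP => /eqP->; rewrite ?Normc.normc0 // normc_real ger0_norm ?sqr_ge0 //.
  by rewrite expr2 ler_piMl // ltW.
have h2 : max_root_modulus (h_eig al (r ^+ 2) (- r ^+ 2) 0 l2) = r.
  apply/eqP; rewrite eq_le; apply/andP; split.
    apply: max_root_modulus_le => // [|z]; first exact: h_eig_neq0.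
    rewrite root_h_eig al2.
    set h := (X in X == 0).
    have {h}-> : h = z * (z - real_complex R r) ^+ 2 by rewrite /h; ring.
    rewrite mulf_eq0 sqrf_eq0 subr_eq0.
    by case/orP => /eqP->; rewrite ?Normc.normc0 ?rc.
  (* The double root [r] attains the bound. *)
  rewrite -{1}rc.
  apply: normc_le_max_root_modulus; first exact: h_eig_neq0.
  by rewrite root_h_eig al2; apply/eqP; ring.
have hN : max_root_modulus (h_eig al (r ^+ 2) (- r ^+ 2) 0 lN) <= r.
  apply: max_root_modulus_le => // [|z]; first exact: h_eig_neq0.
  rewrite root_h_eig alN.
  set h := (X in X == 0).
  have {h}-> : h = z * (z + real_complex R r) ^+ 2 by rewrite /h; ring.
  rewrite mulf_eq0 sqrf_eq0 addr_eq0.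
  by case/orP => /eqP->; rewrite ?Normc.normc0 // -rmorphN normc_real normrN
    ger0_norm.
by rewrite /conv_rate h2 (max_l hN) (max_r h1).
Qed.

Theorem theorem4 (R : realType) (N : nat) (e : rel 'I_N) (A : 'M[R]_N)
    (l2 lN : R) :
  (2 <= N)%N ->
  simple_graph e ->
  connected_graph e ->
  weighted_adjacency e A ->
  smallest_nonzero_eigenvalue (laplacian A) l2 ->
  largest_nonzero_eigenvalue (laplacian A) lN ->
  is_optimal_rate l2 lN
    ((Num.sqrt (lN / l2) - 1) / (Num.sqrt (lN / l2) + 1)) /\
  (forall al th0 th1 th2 : R,
     optimal_parameters l2 lN al th0 th1 th2 <->
     [/\ al = 4 / (Num.sqrt lN + Num.sqrt l2) ^+ 2,
         th0 = ((Num.sqrt (lN / l2) - 1) / (Num.sqrt (lN / l2) + 1)) ^+ 2,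
         th1 = - th0
       & th2 = 0]).
Proof.
move=> _ _ _ adj [l2_eig l2N0 l2_min] [lN_eig lNN0 _].
have l2_gt0 : 0 < l2.
  by rewrite lt_neqAle eq_sym l2N0 (laplacian_eigenvalue_ge0 _ _ _ _ adj).
have l2_le : l2 <= lN by apply: l2_min.
(* In terms of [u] and [q] all square roots disappear: l2 = u^2 and lN = (q u)^2. *)
pose u := Num.sqrt l2; pose q := Num.sqrt (lN / l2).
have u_gt0 : 0 < u by rewrite sqrtr_gt0.
have q_ge1 : 1 <= q.
  by rewrite -[leLHS]sqrtr1 ler_wsqrtr // ler_pdivlMr // mul1r.
have l2E : l2 = u ^+ 2 by rewrite sqr_sqrtr // ltW.
have lNE : lN = (q * u) ^+ 2.
  rewrite exprMn -l2E sqr_sqrtr ?divfK //.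
  by rewrite divr_ge0 // ltW // (lt_le_trans l2_gt0).
have sqrt_lNE : Num.sqrt lN = q * u.
  by rewrite lNE sqrtr_sqr ger0_norm // mulr_ge0; lra.
rewrite sqrt_lNE -/q -/u.
set al0 := 4 / _ ^+ 2; set r := (q - 1) / (q + 1).
have q1 : q + 1 != 0 by lra.
have u0 : u != 0 by lra.
have qu : q * u + u != 0 by rewrite -[X in _ + X]mul1r -mulrDl mulf_neq0.
have r01 : 0 <= r < 1.
  rewrite /r ler_pdivlMr ?ltr_pdivrMr; lra.
have al2 : al0 * l2 = (1 - r) ^+ 2.
  by rewrite /al0 /r l2E; field; rewrite q1 qu.
have alN : al0 * lN = (1 + r) ^+ 2.
  by rewrite /al0 /r lNE; field; rewrite q1 qu.
have ratio : (1 + r) ^+ 2 * l2 = (1 - r) ^+ 2 * lN.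
  by rewrite -al2 -alN mulrAC.
have rate0 : conv_rate l2 lN al0 (r ^+ 2) (- r ^+ 2) 0 = r.
  exact: conv_rate_optimal.
have optimal al th0 th1 th2 : th0 + th1 + th2 = 0 ->
    conv_rate l2 lN al th0 th1 th2 <= r ->
    [/\ al = al0, th0 = r ^+ 2, th1 = - r ^+ 2 & th2 = 0].
  move=> thE /(conv_rate_le_optimal _ _ _ _ _ _ _ r01 ratio thE)[alE -> -> ->].
  by split=> //; apply: (mulIf l2N0); rewrite alE.
have opt_rate : is_optimal_rate l2 lN r.
  split; first by exists al0, (r ^+ 2), (- r ^+ 2), 0; rewrite subrr addr0.
  (* A rate below [r] would force the claimed parameters, whose rate is [r]. *)
  move=> al th0 th1 th2 thE; rewrite leNgt; apply/negP => lt_r.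
  have [alE th0E th1E th2E] := optimal _ _ _ _ thE (ltW lt_r).
  by move: lt_r; rewrite alE th0E th1E th2E rate0 ltxx.
split=> // al th0 th1 th2; split.
  move=> [thE [_ /(_ al0 (r ^+ 2) (- r ^+ 2) 0)]].
  rewrite subrr addr0 rate0 => /(_ erefl) /(optimal _ _ _ _ thE)[-> -> -> ->].
  by [].
move=> [-> -> -> ->]; split; first by rewrite subrr addr0.
by rewrite rate0.
Qed.
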